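(* Let $\{X_i\}_{i=1}^\infty$ be an i.i.d. sequence of random variables on the sublinear expectation space $(\Omega,\mathcal{F},\mathcal{P})$ with $\lim_{\lambda\to+\infty}\mathbb{E}^{\mathcal{P}}[(|X_1|-\lambda)^+]=0$. Then for every continuous function $\varphi:\mathbb{R}\to\mathbb{R}$ satisfying the linear growth condition, $$\lim_{n\to\infty}\mathbb{E}^{\mathcal{P}}\Big[\varphi\Big(\frac{X_1+\cdots+X_n}{n}\Big)\Big]=\max_{-\mathbb{E}^{\mathcal{P}}[-X_1]\le\mu\le\mathbb{E}^{\mathcal{P}}[X_1]}\varphi(\mu).$$
   Context: $\Omega$ is a complete separable metric space, $\mathcal{F}$ its Borel $\sigma$-algebra, and $\mathcal{P}$ is a (nonempty) set of probability measures on $(\Omega,\mathcal{F})$; $(\Omega,\mathcal{F},\mathcal{P})$ is called a sublinear expectation space. For a random variable $X$, $\mathbb{E}^{\mathcal{P}}[X]:=\sup_{P\in\mathcal{P}}E_P[X]$, where $E_P$ is the usual expectation under $P$. $C_{b,Lip}(\mathbb{R}^m)$ is the set of bounded Lipschitz functions on $\mathbb{R}^m$. Linear growth: $|\varphi(x)|\le C(1+|x|)$ for some constant $C$ and all $x$. I.i.d. (in Peng's sense) means: (identically distributed) $\mathbb{E}^{\mathcal{P}}[\varphi(X_i)]=\mathbb{E}^{\mathcal{P}}[\varphi(X_1)]$ for all $i$ and all $\varphi\in C_{b,Lip}(\mathbb{R})$; and (independent) for each $n\in\mathbb{N}$ and each $\varphi\in C_{b,Lip}(\mathbb{R}^{n+1})$,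 $\mathbb{E}^{\mathcal{P}}[\varphi(X_1,\dots,X_{n+1})]=\mathbb{E}^{\mathcal{P}}\big[\mathbb{E}^{\mathcal{P}}[\varphi(x_1,\dots,x_n,X_{n+1})]|_{(x_1,\dots,x_n)=(X_1,\dots,X_n)}\big]$. *)

(* Defs.v *)
From HB Require Import structures.
From mathcomp Require Import all_boot all_order all_algebra.
From mathcomp Require Import all_classical all_reals all_analysis.

Set Implicit Arguments.
Unset Strict Implicit.
Unset Printing Implicit Defensive.

Import Order.TTheory GRing.Theory Num.Theory.
Import numFieldNormedType.Exports.

Local Open Scope classical_set_scope.
Local Open Scope ring_scope.

(* The point required by [Complete] (and by [measurableType]) is no restriction
   for a space that carries a probability measure, hence is nonempty. *)
#[short(type="completeMetricType")]
HB.structure Definition CompleteMetric (K : numDomainType) :=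
  {T of Metric K T & Complete T}.

Definition separable (T : topologicalType) : Prop :=
  exists2 D : set T, countable D & dense D.

Notation borel T := (g_sigma_algebraType (@open T)).

Section sublinear_expectation.
Context d (T : measurableType d) (R : realType).
Implicit Types (PP : set (probability T R)) (X : nat -> T -> R).

Definition sublinear_expectation PP (Y : T -> R) : \bar R :=
  ereal_sup [set 'E_P[Y]%E | P in PP].

Definition bounded_lipschitz (V : normedModType R) (phi : V -> R) : Prop :=
  bounded_fun phi /\ lipschitz phi.

(* (X_1, ..., X_n), with X_(i+1) stored as [X i] *)
Definition initial_vector X (n : nat) (w : T) : 'rV[R]_n := \row_(i < n) X i w.

(* (x_1, ..., x_n, y) *)
Definition rV_rcons (n : nat) (x : 'rV[R]_n) (y : R) : 'rV[R]_n.+1 :=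
  \row_(i < n.+1) if unlift ord_max i is Some j then x 0 j else y.

Definition identically_distributed PP X : Prop :=
  forall (i : nat) (phi : R -> R), bounded_lipschitz phi ->
    sublinear_expectation PP (phi \o X i) =
    sublinear_expectation PP (phi \o X 0%N).

(* [fine] only casts the inner expectation to R: it is finite, because phi is
   bounded and PP is nonempty in the intended use. The case n = 0 always holds. *)
Definition peng_independent PP X : Prop :=
  forall (n : nat) (phi : 'rV[R]_n.+1 -> R), bounded_lipschitz phi ->
    sublinear_expectation PP (phi \o initial_vector X n.+1) =
    sublinear_expectation PP
      ((fun x : 'rV[R]_n =>
          fine (sublinear_expectation PP (fun w => phi (rV_rcons x (X n w)))))
       \o initial_vector X n).

Definition peng_iid PP X : Prop :=
  identically_distributed PP X /\ peng_independent PP X.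

End sublinear_expectation.

Definition linear_growth (R : realType) (phi : R -> R) : Prop :=
  exists C : R, forall x : R, `|phi x| <= C * (1 + `|x|).

Definition is_maximum (R : realType) (A : set R) (m : R) : Prop :=
  A m /\ ubound A m.

(* Main.v *)
Require Import Defs.
From HB Require Import structures.
From mathcomp Require Import all_boot all_order all_algebra.
From mathcomp Require Import all_classical all_reals all_analysis.
From mathcomp Require Import measurable_realfun ring lra.

Set Implicit Arguments.
Unset Strict Implicit.
Unset Printing Implicit Defensive.

Import Order.TTheory GRing.Theory Num.Theory.
Import numFieldNormedType.Exports.

Local Open Scope classical_set_scope.
Local Open Scope ring_scope.

(** Write U for the sublinear expectation, S_n for X_1 + ... + X_n, and
    [l, u] for the interval from -U(-X_1) to U(X_1); every linear expectation
    E_P X_1 with P in PP lies in [l, u].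

    The heart of the matter is a one-step estimate for a bounded Lipschitz
    function psi that is semiconcave, in the sense that
    psi(s + y) <= psi(s) + p(s) y + min(y^2, 4|y|) for some slope p.  Putting
    y = (X_1 - mu)/n and integrating under P, the remainder contributes o(1/n)
    uniformly in P and s: this is where uniform integrability enters
    ([min_sqr_lin_le], [step_error_small]).  Hence
      E_P psi(s + (X_1 - mu)/n) <= psi(s) + p(s) (E_P X_1 - mu)/n + o(1/n).
    Peng's independence, together with identical distribution, says that
    U psi(S_k+1 centred and scaled) is U of such a one-step expectation started
    at S_k ([walk_conditioning]); so n steps accumulate an error n o(1/n) = o(1),
    as soon as the drift term has the right sign:
    - if p(s) (E_P X_1 - mu) <= 0 for all P, then limsup U psi(S_n/n - mu) is at
      most psi(0).  Taking for psi the square truncated at 1 of the positive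
      part, with mu = u, or of the negative part, with mu = l, shows that S_n/n
      stays near [l, u] in the limit;
    - if l <= mu <= u, then whatever the sign of p(s) some P in PP makes the
      drift of -psi nonnegative, up to any error, so liminf U(-psi(S_n/n - mu))
      is at least -psi(0).  Taking for psi the square truncated at 1 shows that
      S_n/n can be steered to mu under measures of PP.

    It remains to dominate: for a continuous phi of linear growth, phi - max phi
    is at most e plus a multiple of the two one-sided test functions plus a
    multiple of (|x| - lambda)^+, and phi(mu) - phi is at most e plus a multiple
    of the truncated square of x - mu plus a multiple of (|x| - lambda)^+
    ([linear_growth_domination]).  The last term is controlled uniformly in n,
    because U (|S_n/n| - lambda)^+ <= U (|X_1| - lambda)^+ by convexity
    ([excess_mean_le]), with a multiple that does not depend on lambda. *)

(** * Semiconcave test functions *)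

Section truncated_square.
Context {R : realFieldType}.
Implicit Types u v y z : R.

Definition tsqr u : R := Num.min (u ^+ 2) 1.

Definition tsqr_slope u : R := if `|u| <= 1 then 2 * u else 0.

Lemma tsqr0 : tsqr 0 = 0.
Proof. by rewrite /tsqr expr0n /= min_l. Qed.

Lemma tsqr_ge0 u : 0 <= tsqr u.
Proof. by rewrite /tsqr le_min sqr_ge0 ler01. Qed.

Lemma norm_tsqr_le1 u : `|tsqr u| <= 1.
Proof. by rewrite ger0_norm ?tsqr_ge0// /tsqr ge_min lexx orbT. Qed.

Lemma le_tsqr u v : `|u| <= `|v| -> tsqr u <= tsqr v.
Proof.
move=> uv; rewrite /tsqr le_min2//.
by rewrite -(real_normK (num_real u)) -(real_normK (num_real v)) lerXn2r ?nnegrE.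
Qed.

Lemma tsqr_small u : `|u| <= 1 -> tsqr u = u ^+ 2.
Proof. by move=> u1; rewrite /tsqr min_l// -real_normK ?num_real// exprn_ile1. Qed.

Lemma tsqr_large u : 1 < `|u| -> tsqr u = 1.
Proof.
by move=> /ltW u1; rewrite /tsqr min_r// -real_normK ?num_real// exprn_ege1.
Qed.

Lemma tsqr_lipschitz u v : `|tsqr u - tsqr v| <= 2 * `|u - v|.
Proof.
wlog uv : u v / `|u| <= `|v| => [hw|].
  by have [/hw//|/ltW/hw] := leP `|u| `|v|; rewrite distrC [`|v - u|]distrC.
rewrite distrC ger0_norm ?subr_ge0 ?le_tsqr//.
have d : `|v| - `|u| <= `|u - v| by rewrite distrC lerB_dist.
have u0 := normr_ge0 u.
have [v1|v1] := leP `|v| 1.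
  rewrite !tsqr_small//; last exact: le_trans v1.
  rewrite -(real_normK (num_real u)) -(real_normK (num_real v)); nra.
rewrite (tsqr_large v1); have [u1|u1] := leP `|u| 1.
  rewrite tsqr_small// -(real_normK (num_real u)); nra.
by rewrite tsqr_large// subrr mulr_ge0.
Qed.

Lemma norm_tsqr_slope u : `|tsqr_slope u| <= 2.
Proof.
rewrite /tsqr_slope; case: ifP => u1; last by rewrite normr0.
by rewrite normrM normr_nat; lra.
Qed.

(** Both bounds hide in the remainder: the quadratic one because tsqr is a
    minimum of two functions that obey it, the linear one because tsqr and its
    tangents are 2-Lipschitz. *)
Lemma tsqrD_le u z :
  tsqr (u + z) <= tsqr u + tsqr_slope u * z + Num.min (z ^+ 2) (4 * `|z|).
Proof.
have Lz : tsqr (u + z) <= tsqr u + tsqr_slope u * z + 4 * `|z|.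
  have := tsqr_lipschitz (u + z) u; rewrite addrAC subrr add0r => /ler_normlW h.
  have : - (tsqr_slope u * z) <= 2 * `|z|.
    rewrite (le_trans (ler_norm _))// normrN normrM ler_wpM2r//.
    exact: norm_tsqr_slope.
  lra.
have Qz : tsqr (u + z) <= tsqr u + tsqr_slope u * z + z ^+ 2.
  have h1 : tsqr (u + z) <= 1 by rewrite /tsqr ge_min lexx orbT.
  have h2 : tsqr (u + z) <= (u + z) ^+ 2 by rewrite /tsqr ge_min lexx.
  rewrite /tsqr_slope; case: ifPn => [u1|]; last first.
    by rewrite -ltNge => u1; rewrite (tsqr_large u1) mul0r; have := sqr_ge0 z; lra.
  by rewrite (tsqr_small u1); lra.
by rewrite /Num.min; case: ifP.
Qed.

(** The remainder is quadratic for small y, which makes it o(1/n) at scale 1/n,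
    and linear for large y, so that it is integrable as soon as y is. *)
Definition semiconcave_with (psi p : R -> R) :=
  forall s y, psi (s + y) <= psi s + p s * y + Num.min (y ^+ 2) (4 * `|y|).

Definition overshoot x : R := tsqr (Num.max x 0).
Definition undershoot x : R := tsqr (Num.max (- x) 0).

Lemma tsqr_slope_ge0 u : 0 <= u -> 0 <= tsqr_slope u.
Proof. by move=> u0; rewrite /tsqr_slope; case: ifP => // _; rewrite mulr_ge0. Qed.

(** Turns the semiconcavity of tsqr into that of its composition with the
    positive part, with the same slope: tsqr only sees absolute values. *)
Lemma max0D_le x y : `|Num.max (x + y) 0| <= `|Num.max x 0 + y|.
Proof.
have [xy|xy] := leP (x + y) 0; first by rewrite normr0.
rewrite gtr0_norm//; apply: (le_trans _ (ler_norm _)); rewrite lerD2r.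
by rewrite le_max lexx.
Qed.

Lemma max0_lipschitz x y : `|Num.max x 0 - Num.max y 0| <= `|x - y|.
Proof.
have := ler_norm (x - y); have := ler_norm (y - x); rewrite (distrC y).
have := normr_ge0 (x - y); rewrite ler_norml.
case: (leP x 0) => ?; case: (leP y 0) => ?; lra.
Qed.

Lemma tsqr_semiconcave : semiconcave_with tsqr tsqr_slope.
Proof. by move=> s y; exact: tsqrD_le. Qed.

Lemma overshoot_semiconcave :
  semiconcave_with overshoot (fun x => tsqr_slope (Num.max x 0)).
Proof.
by move=> s y; apply: le_trans (tsqrD_le _ _); apply/le_tsqr/max0D_le.
Qed.

Lemma undershoot_semiconcave :
  semiconcave_with undershoot (fun x => - tsqr_slope (Num.max (- x) 0)).
Proof.
move=> s y; rewrite mulNr -mulrN -(sqrrN y) -(normrN y); apply: le_trans (tsqrD_le _ _).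
by apply/le_tsqr; rewrite opprD max0D_le.
Qed.

Lemma overshoot_lipschitz x y : `|overshoot x - overshoot y| <= 2 * `|x - y|.
Proof. by apply: le_trans (tsqr_lipschitz _ _) _; rewrite ler_wpM2l// max0_lipschitz. Qed.

Lemma undershoot_lipschitz x y : `|undershoot x - undershoot y| <= 2 * `|x - y|.
Proof.
by have := overshoot_lipschitz (- x) (- y); rewrite -opprD normrN.
Qed.

Lemma overshoot0 : overshoot 0 = 0.
Proof. by rewrite /overshoot maxxx tsqr0. Qed.

Lemma undershoot0 : undershoot 0 = 0.
Proof. by rewrite /undershoot oppr0 maxxx tsqr0. Qed.

Lemma tsqr_gt0 u : 0 < u -> 0 < tsqr u.
Proof. by move=> u0; rewrite /tsqr lt_min exprn_gt0// ltr01. Qed.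

End truncated_square.

(** * Excess over a threshold *)

Section excess.
Context {R : realFieldType}.
Implicit Types lam mu x y z : R.

Definition excess (lam x : R) : R := Num.max (`|x| - lam) 0.

Lemma excess_ge0 lam x : 0 <= excess lam x.
Proof. by rewrite le_max lexx orbT. Qed.

Lemma norm_le_excess lam x : `|x| <= lam + excess lam x.
Proof. by rewrite -lerBlDl le_max lexx. Qed.

Lemma excess_lipschitz lam x y : `|excess lam x - excess lam y| <= `|x - y|.
Proof.
have := lerB_dist x y; have := lerB_dist y x; rewrite (distrC y).
rewrite /excess; move: `|x| `|y| => a b h1 h2; rewrite ler_norml.
case: (leP (a - lam)) => ?; case: (leP (b - lam)) => ?; lra.
Qed.

Lemma excessB lam mu x : excess (lam + `|mu|) (x - mu) <= excess lam x.
Proof.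
rewrite /excess ge_max excess_ge0 andbT le_max; apply/orP; left.
by have := ler_normB x mu; lra.
Qed.

(** Convexity of the excess. *)
Lemma excess_mean lam n (x : nat -> R) : 0 <= lam ->
  excess lam ((\sum_(i < n) x i) / n%:R) <= n%:R^-1 * \sum_(i < n) excess lam (x i).
Proof.
case: n => [|n] lam0; first by rewrite !big_ord0 mul0r mulr0 /excess normr0 max_r//; lra.
have n0 : 0 < n.+1%:R :> R by rewrite ltr0n.
rewrite {1}/excess ge_max; apply/andP; split; last first.
  by rewrite mulr_ge0 ?invr_ge0 ?(ltW n0)// sumr_ge0// => i _; exact: excess_ge0.
rewrite normrM [in leLHS]mulrC gtr0_norm ?invr_gt0// lerBlDr.
have -> : n.+1%:R^-1 * \sum_(i < n.+1) excess lam (x i) + lam =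
    n.+1%:R^-1 * \sum_(i < n.+1) (lam + excess lam (x i)).
  by rewrite big_split/= sumr_const card_ord -(mulr_natl lam) mulrDr mulKf ?lt0r_neq0// addrC.
rewrite ler_wpM2l ?invr_ge0 ?(ltW n0)//; apply: le_trans (ler_norm_sum _ _ _) _.
by apply: ler_sum => i _; exact: norm_le_excess.
Qed.

(** The uniform o(1/n) bound on the semiconcavity remainder: use the quadratic
    branch when |z| <= 2 lam, and otherwise the linear branch together with
    |z| <= 2 (|z| - lam). *)
Lemma min_sqr_lin_le (n lam z : R) : 0 < n -> 0 <= lam ->
  Num.min ((n^-1 * z) ^+ 2) (4 * `|n^-1 * z|) <=
  n^-1 * (4 * lam ^+ 2 / n + 8 * excess lam z).
Proof.
rewrite /excess => n0 lam0; have ni0 : 0 < n^-1 by rewrite invr_gt0.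
rewrite normrM (gtr0_norm ni0).
have m1 : `|z| - lam <= Num.max (`|z| - lam) 0 by rewrite le_max lexx.
have m2 : 0 <= Num.max (`|z| - lam) 0 by rewrite le_max lexx orbT.
have [zl|zl] := leP `|z| (2 * lam).
  rewrite ge_min; apply/orP; left.
  rewrite expr2 mulrACA mulrDr -mulrA -[z * z]expr2 -(real_normK (num_real z)).
  have := normr_ge0 z; move: (Num.max _ _) m2 => m m2 z0.
  have h : `|z| ^+ 2 <= 4 * lam ^+ 2 by nra.
  have := ler_wpM2l (ltW ni0) (ler_wpM2l (ltW ni0) h).
  have : 0 <= n^-1 * (8 * m) by rewrite mulr_ge0 ?mulr_ge0 ?(ltW ni0).
  rewrite -[4 * lam ^+ 2 / n]mulrC; lra.
rewrite ge_min; apply/orP; right.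
rewrite mulrCA ler_wpM2l ?(ltW ni0)//.
have : 0 <= 4 * lam ^+ 2 / n by rewrite mulr_ge0 ?mulr_ge0 ?sqr_ge0 ?(ltW ni0).
lra.
Qed.

End excess.

(** * Linear expectations *)

Section expectation_extra.
Context d (T : measurableType d) (R : realType) (P : probability T R).
Implicit Types f g : T -> R.
Local Open Scope ereal_scope.

(** Monotonicity read off from the definition of the integral as a supremum over
    simple functions.  This form applies at once to the inner expectation in
    [walk_conditioning], a supremum over PP, without a proof of its
    measurability. *)
Lemma ge0_integral_homo (f g : T -> \bar R) : (forall w, 0 <= f w) ->
  (forall w, f w <= g w) -> \int[P]_w f w <= \int[P]_w g w.
Proof.
move=> f0 fg; rewrite !ge0_integralTE//; last by move=> w; exact: le_trans (fg w).
by apply: ereal_sup_le => _ [h hf <-]; exists h => // w; exact: le_trans (fg w).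
Qed.

Lemma expectation_homo f g : (forall w, (f w <= g w)%R) -> 'E_P[f] <= 'E_P[g].
Proof.
move=> fg; rewrite unlock integralE [leRHS]integralE leeB//.
- by apply: ge0_integral_homo => // w; rewrite !funeposE ge_max !le_max lee_fin fg lexx orbT.
- apply: ge0_integral_homo => // w.
  by rewrite !funenegE ge_max !le_max leeN2 lee_fin fg lexx orbT.
Qed.

Lemma le_Lfun1 f g : measurable_fun setT f ->
  (forall w, (`|f w| <= g w)%R) -> g \in Lfun P 1 -> f \in Lfun P 1.
Proof.
move=> mf fg /Lfun1_integrable ig; apply/Lfun1_integrable.
apply: le_integrable ig => //; first exact/measurable_EFinP.
by move=> w _; rewrite /= lee_fin (le_trans (fg w))// ler_norm.
Qed.

Lemma bounded_Lfun1 f (B : R) : measurable_fun setT f ->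
  (forall w, (`|f w| <= B)%R) -> f \in Lfun P 1.
Proof. by move=> mf fB; apply: (le_Lfun1 mf fB); exact: Lfun_cst. Qed.

Lemma expectationDcst f (c : R) : f \in Lfun P 1 ->
  'E_P[fun w => (f w + c)%R] = 'E_P[f] + c%:E.
Proof.
by move=> f1; rewrite -[X in _ + X](expectation_cst P) -expectationD// Lfun_cst.
Qed.

Lemma expectationZ f (k : R) : f \in Lfun P 1 ->
  'E_P[fun w => (k * f w)%R] = k%:E * 'E_P[f].
Proof.
by move=> f1; rewrite -expectationZl//; congr expectation; apply/funext => w /=; rewrite mulrC.
Qed.

Lemma Lfun1Z f (k : R) : f \in Lfun P 1 -> (fun w => k * f w)%R \in Lfun P 1.
Proof. by move=> f1; exact: (@rpredZ _ _ _ k f). Qed.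

Lemma Lfun1D f g : f \in Lfun P 1 -> g \in Lfun P 1 -> (fun w => f w + g w)%R \in Lfun P 1.
Proof. by move=> f1 g1; exact: rpredD. Qed.

Lemma expectation_affine f g (c0 c1 c2 : R) :
  f \in Lfun P 1 -> g \in Lfun P 1 ->
  'E_P[fun w => (c0 + c1 * f w + c2 * g w)%R] =
  (c0 + c1 * fine 'E_P[f] + c2 * fine 'E_P[g])%R%:E.
Proof.
move=> f1 g1; have c1f : (fun w => c0 + c1 * f w)%R \in Lfun P 1.
  by apply: (@Lfun1D (cst c0)); [exact: Lfun_cst|exact: Lfun1Z].
rewrite (@expectationD _ _ _ _ (fun w => c0 + c1 * f w)%R)//; last exact: Lfun1Z.
rewrite (@expectationD _ _ _ _ (cst c0)) ?Lfun_cst//; last exact: Lfun1Z.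
rewrite expectation_cst !expectationZ// !EFinD !EFinM !fineK//; exact: expectation_fin_num.
Qed.

End expectation_extra.

(** * Sublinear expectations *)

Section sublinear_expectation_theory.
Context d (T : measurableType d) (R : realType) (PP : set (probability T R)).
Implicit Types (Y Z : T -> R) (P : probability T R).
Local Notation U := (sublinear_expectation PP).
Local Open Scope ereal_scope.

Lemma expectation_le_sublinear P Y : PP P -> 'E_P[Y] <= U Y.
Proof. by move=> PPP; apply: ereal_sup_ubound; exists P. Qed.

Lemma sublinear_le Y (c : \bar R) :
  (forall P, PP P -> 'E_P[Y] <= c) -> U Y <= c.
Proof. by move=> Yc; apply: ge_ereal_sup => _ [P PPP <-]; exact: Yc. Qed.

Lemma sublinear_homo Y Z : (forall w, (Y w <= Z w)%R) -> U Y <= U Z.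
Proof.
move=> YZ; apply: sublinear_le => P PPP.
exact: le_trans (expectation_homo P YZ) (expectation_le_sublinear Z PPP).
Qed.

Lemma sublinear_le_cst Y (c : R) : (forall w, (Y w <= c)%R) -> U Y <= c%:E.
Proof.
move=> Yc; apply: sublinear_le => P PPP.
by rewrite -(expectation_cst P c); exact: expectation_homo.
Qed.

Lemma sublinear_ge_cst Y (c : R) : PP !=set0 ->
  (forall w, (c <= Y w)%R) -> c%:E <= U Y.
Proof.
move=> [P PPP] cY; apply: le_trans (expectation_le_sublinear Y PPP).
by rewrite -(expectation_cst P c); exact: expectation_homo.
Qed.

Lemma sublinear_fin_num Y (B : R) : PP !=set0 ->
  (forall w, (`|Y w| <= B)%R) -> U Y \is a fin_num.
Proof.
move=> PP0 YB; rewrite fin_numElt; apply/andP; split.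
- apply: (@lt_le_trans _ _ (- B)%:E); first exact: ltNyr.
  by apply: sublinear_ge_cst => // w; have := YB w; rewrite ler_norml => /andP[].
- apply: (@le_lt_trans _ _ B%:E); last exact: ltry.
  by apply: sublinear_le_cst => w; rewrite (le_trans (ler_norm _)).
Qed.

Lemma sublinearDcst Y (c B : R) : measurable_fun setT Y ->
  (forall w, (`|Y w| <= B)%R) -> U (fun w => (Y w + c)%R) = U Y + c%:E.
Proof.
have le Y' c' B' : measurable_fun setT Y' ->
    (forall w, (`|Y' w| <= B')%R) -> U (fun w => (Y' w + c')%R) <= U Y' + c'%:E.
  move=> mY YB; apply: sublinear_le => P PPP.
  rewrite expectationDcst ?leeD2r ?expectation_le_sublinear//.
  exact: (bounded_Lfun1 _ mY YB).
move=> mY YB; apply/eqP; rewrite eq_le (le _ _ _ mY YB)/=.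
rewrite -leeBrDr//.
have -> : U Y = U (fun w => ((Y w + c) + - c)%R).
  by congr (U _); apply/funext => w; rewrite addrK.
apply: (le _ _ (B + `|c|)%R); first exact: measurable_funD.
by move=> w; rewrite (le_trans (ler_normD _ _))// lerD2r.
Qed.

End sublinear_expectation_theory.

(** * Peng independence as a dynamic programming principle *)

Section peng_random_walk.
Context {R : realType}.

Lemma bounded_lipschitzI (V : normedModType R) (f : V -> R) (B K : R) :
  (forall x, `|f x| <= B) -> (forall x y, `|f x - f y| <= K * `|x - y|) ->
  bounded_lipschitz f.
Proof.
move=> fB fK; split; last first.
  exists K; split; [exact: num_real|move=> M KM [x y] _ /=].
  by apply: le_trans (fK x y) _; rewrite ler_wpM2r// ltW.
by exists B; split; [exact: num_real|move=> M BM x _; exact: le_trans (fB x) (ltW BM)].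
Qed.

Lemma lipschitz_measurable (f : R -> R) (K : R) :
  (forall x y, `|f x - f y| <= K * `|x - y|) -> measurable_fun setT f.
Proof.
move=> fK; apply: continuous_measurable_fun => x.
apply/cvgrPdist_lt => e e0; near=> y.
rewrite (le_lt_trans (fK x y))//.
rewrite (@le_lt_trans _ _ ((`|K| + 1) * `|x - y|))//.
  by rewrite ler_wpM2r//; have := ler_norm K; lra.
rewrite mulrC -ltr_pdivlMr; last by rewrite ltr_wpDl.
near: y; apply: cvgr_dist_lt; first exact: cvg_id.
by rewrite divr_gt0// ltr_wpDl.
Unshelve. all: by end_near. Qed.

Lemma norm_entry_le n (x : 'rV[R]_n) i : `|x 0 i| <= `|x|.
Proof.
rewrite [leRHS]/Num.norm/= mx_normrE.
exact: (le_bigmax _ (fun ij : 'I_1 * 'I_n => `|x ij.1 ij.2|) (0, i)).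
Qed.

Context d (T : measurableType d) (PP : set (probability T R)).
Context (X : nat -> T -> R) (iidX : peng_iid PP X).
Local Notation U := (sublinear_expectation PP).

Definition walk (a mu : R) (k : nat) (w : T) : R := \sum_(i < k) a * (X i w - mu).

(** Peng independence conditions on the first k variables; identical
    distribution then replaces the last variable by the first one, so that all
    steps of the walk obey the same estimate. *)
Lemma walk_conditioning (psi : R -> R) (B K a mu : R) (k : nat) :
  (forall x, `|psi x| <= B) -> (forall x y, `|psi x - psi y| <= K * `|x - y|) ->
  U (psi \o walk a mu k.+1) =
  U (fun w => fine (U (fun w' => psi (walk a mu k w + a * (X 0%N w' - mu))))).
Proof.
move=> psiB psiK.
have K0 : 0 <= K by have := psiK 1 0; rewrite subr0 normr1 mulr1; apply: le_trans.
pose phi (x : 'rV[R]_k.+1) := psi (\sum_i a * (x 0 i - mu)).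
have blphi : bounded_lipschitz phi.
  apply: (@bounded_lipschitzI _ _ B (K * (`|a| *+ k.+1))) => [x|x y]; first exact: psiB.
  apply: le_trans (psiK _ _) _; rewrite -mulrA ler_wpM2l// -sumrB.
  apply: le_trans (ler_norm_sum _ _ _) _; rewrite mulrnAl.
  rewrite (_ : _ *+ _ = \sum_(i < k.+1) `|a| * `|x - y|); last by rewrite sumr_const card_ord.
  apply: ler_sum => i _; rewrite -mulrBr normrM ler_wpM2l//.
  rewrite opprB addrA subrK; have := norm_entry_le (x - y) i; by rewrite !mxE.
have [idX indX] := iidX.
have -> : psi \o walk a mu k.+1 = phi \o initial_vector X k.+1.
  apply/funext => w; rewrite /phi /walk /=; congr psi.
  by apply: eq_bigr => i _; rewrite mxE.
rewrite (indX k phi blphi); congr (U _); apply/funext => w /=; congr fine.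
pose f x := psi (walk a mu k w + a * (x - mu)).
have blf : bounded_lipschitz f.
  apply: (@bounded_lipschitzI _ _ B (K * `|a|)) => [x|x y]; first exact: psiB.
  apply: le_trans (psiK _ _) _; rewrite -mulrA ler_wpM2l// -normrM.
  by rewrite le_eqVlt; apply/orP; left; apply/eqP; congr (`| _ |); ring.
rewrite -[RHS](idX k f blf); congr (U _); apply/funext => w'; rewrite /phi /f /walk /=.
congr psi; rewrite big_ord_recr /=; congr (_ + _).
  apply: eq_bigr => i _; rewrite !mxE.
  have -> : widen_ord (leqnSn k) i = lift ord_max i.
    by apply: val_inj; rewrite /= /bump leqNgt ltn_ord.
  by rewrite liftK mxE.
by rewrite mxE unlift_none.
Qed.

End peng_random_walk.

Section walk_estimates.
Context d (T : measurableType d) (R : realType) (PP : set (probability T R)).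
Context (PP0 : PP !=set0) (X : nat -> T -> R).
Context (mX : forall i, measurable_fun setT (X i)) (iidX : peng_iid PP X).
Local Notation U := (sublinear_expectation PP).
Local Notation walk := (walk X).
Implicit Types (P : probability T R).

Lemma measurable_walk a mu k : measurable_fun setT (walk a mu k).
Proof.
apply: measurable_sum => i; apply: measurable_funM => //.
exact: measurable_funB.
Qed.

Section bounded_lipschitz_function.
Context (psi : R -> R) (B K a mu c : R).
Hypothesis psiB : forall x, `|psi x| <= B.
Hypothesis psiK : forall x y, `|psi x - psi y| <= K * `|x - y|.

Let step_fin s : U (fun w => psi (s + a * (X 0%N w - mu))) \is a fin_num.
Proof. by apply: (@sublinear_fin_num _ _ _ _ _ B). Qed.

Let mpsiW k : measurable_fun setT (psi \o walk a mu k).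
Proof.
apply: measurableT_comp; last exact: measurable_walk.
exact: lipschitz_measurable psiK.
Qed.

(** One-step estimates add up along the walk; the only operations on U that the
    induction uses are monotonicity and translation by constants. *)
Lemma walk_expectation_le :
  (forall s, (U (fun w => psi (s + a * (X 0%N w - mu))) <= (psi s + c)%:E)%E) ->
  forall k, (U (psi \o walk a mu k) <= (psi 0 + c *+ k)%:E)%E.
Proof.
move=> step; elim=> [|k IH].
  by apply: sublinear_le_cst => w; rewrite /walk /= big_ord0 addr0.
rewrite (walk_conditioning iidX _ _ _ psiB psiK).
apply: (@le_trans _ _ (U (fun w => psi (walk a mu k w) + c))).
  by apply: sublinear_homo => w; rewrite -lee_fin fineK.
rewrite (@sublinearDcst _ _ _ _ (psi \o walk a mu k) c B);
  [|exact: mpsiW|by move=> w; exact: psiB].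
by rewrite mulrSr addrA EFinD leeD2r.
Qed.

Lemma walk_expectation_ge :
  (forall s, ((psi s - c)%:E <= U (fun w => psi (s + a * (X 0%N w - mu))))%E) ->
  forall k, ((psi 0 - c *+ k)%:E <= U (psi \o walk a mu k))%E.
Proof.
move=> step; elim=> [|k IH].
  by apply: sublinear_ge_cst => // w; rewrite /walk /= big_ord0 subr0.
rewrite (walk_conditioning iidX _ _ _ psiB psiK).
apply: (@le_trans _ _ (U (fun w => psi (walk a mu k w) - c))).
  rewrite (@sublinearDcst _ _ _ _ (psi \o walk a mu k) (- c) B);
    [|exact: mpsiW|by move=> w; exact: psiB].
  by rewrite mulrSr opprD addrA EFinD leeD2r.
by apply: sublinear_homo => w; rewrite -lee_fin fineK.
Qed.

End bounded_lipschitz_function.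

End walk_estimates.

(** * Uniform integrability *)

Section uniform_integrability.
Context {R : realType}.

Lemma measurable_excess (lam : R) : measurable_fun setT (excess lam : R -> R).
Proof.
by apply: (@lipschitz_measurable _ _ 1) => x y; rewrite mul1r excess_lipschitz.
Qed.

Context d (T : measurableType d) (PP : set (probability T R)).
Context (X : nat -> T -> R).
Context (mX : forall i, measurable_fun setT (X i)).
Context (idX : identically_distributed PP X).
Local Notation U := (sublinear_expectation PP).
Implicit Types (P : probability T R).

(** The excess is Lipschitz but unbounded, so identical distribution only applies
    to its truncations; monotone convergence under a fixed P recovers it. *)
Lemma excess_identically_distributed P i lam : PP P ->
  ('E_P[excess lam \o X i] <= U (excess lam \o X 0%N))%E.
Proof.
move=> PPP; pose trunc (n : nat) x := Num.min (excess lam x) n%:R.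
have trunc_ge0 n x : 0 <= trunc n x by rewrite le_min excess_ge0 ler0n.
have trunc_lip n x y : `|trunc n x - trunc n y| <= 1 * `|x - y|.
  rewrite mul1r; apply: le_trans (excess_lipschitz lam x y).
  rewrite /trunc; move: (excess _ _) (excess _ _) => a b.
  rewrite ler_norml.
  have := ler_norm (a - b); have := ler_norm (b - a); rewrite (distrC b).
  have := normr_ge0 (a - b).
  case: (leP a) => ?; case: (leP b) => ?; lra.
have -> : ('E_P[excess lam \o X i] = \int[P]_w limn (fun n => (trunc n (X i w))%:E))%E.
  rewrite unlock; apply: eq_integral => w _; apply/esym/cvg_lim => //.
  apply: cvg_near_cst; near=> n; rewrite /trunc min_l//.
  near: n; exact: nbhs_infty_ger.
rewrite monotone_convergence//; last 3 first.
- move=> n; apply/measurable_EFinP; apply: measurableT_comp => //.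
  exact: lipschitz_measurable (trunc_lip n).
- by move=> n w _; rewrite lee_fin.
- move=> w _ n m nm; rewrite lee_fin /trunc le_min2//; first by rewrite ler_nat.
apply: lime_le.
  apply: ereal_nondecreasing_is_cvgn => n m nm; apply: ge0_integral_homo => w.
    by rewrite lee_fin.
  by rewrite lee_fin le_min2// ler_nat.
near=> n.
rewrite (_ : (\int[P]_x _)%E = 'E_P[trunc n \o X i]%E); last by rewrite unlock.
apply: le_trans (expectation_le_sublinear _ PPP) _.
rewrite idX; first by apply: sublinear_homo => w; rewrite /= /trunc ge_min lexx.
apply: (@bounded_lipschitzI _ _ _ n%:R 1) => [x|]; last exact: trunc_lip.
by rewrite ger0_norm// /trunc ge_min lexx orbT.
Unshelve. all: by end_near. Qed.

Context (tailX : forall e : R, 0 < e ->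
  exists2 lam : R, 1 <= lam & (U (excess lam \o X 0%N) <= e%:E)%E).

Lemma excess_Lfun1 P i lam e : PP P -> (U (excess lam \o X 0%N) <= e%:E)%E ->
  excess lam \o X i \in Lfun P 1.
Proof.
move=> PPP le_e; apply/Lfun1_integrable/integrableP; split.
  apply/measurable_EFinP; apply: measurableT_comp => //; exact: measurable_excess.
apply: (@le_lt_trans _ _ e%:E); last exact: ltry.
apply: le_trans le_e; apply: le_trans (excess_identically_distributed i lam PPP).
rewrite unlock; apply: ge0_integral_homo => w //=.
by rewrite lee_fin ger0_norm// excess_ge0.
Qed.

Lemma variable_Lfun1 P i : PP P -> X i \in Lfun P 1.
Proof.
move=> PPP; have [lam _ le1] := tailX ltr01.
apply: (@le_Lfun1 _ _ _ _ _ (fun w => lam + excess lam (X i w))) => //.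
  by move=> w; exact: norm_le_excess.
apply: (@Lfun1D _ _ _ _ (cst lam)); first exact: Lfun_cst.
exact: excess_Lfun1 le1.
Qed.

Lemma mean_Lfun1 P n : PP P -> (fun w => (\sum_(i < n) X i w) / n%:R) \in Lfun P 1.
Proof.
move=> PPP; rewrite (_ : (fun w => _) = fun w => n%:R^-1 * \sum_(i < n) X i w); last first.
  by apply/funext => w; rewrite mulrC.
apply: Lfun1Z; elim: n => [|n IH].
  by under eq_fun do rewrite big_ord0; exact: Lfun_cst.
under eq_fun do rewrite big_ord_recr/=.
by apply: Lfun1D => //; exact: variable_Lfun1.
Qed.

(** Uniform integrability passes to the sample means with the same bound. *)
Lemma excess_mean_le P n lam e : PP P -> (0 < n)%N -> 0 <= lam ->
  (U (excess lam \o X 0%N) <= e%:E)%E ->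
  ('E_P[fun w => excess lam ((\sum_(i < n) X i w) / n%:R)] <= e%:E)%E.
Proof.
move=> PPP n0 lam0 le_e.
have n0' : 0 < n%:R :> R by rewrite ltr0n.
apply: (@le_trans _ _ 'E_P[fun w => (n%:R^-1 * \sum_(i < n) excess lam (X i w))%R]%E).
  by apply: expectation_homo => w; exact: (excess_mean n (X^~ w)).
have [L1 LE] : (fun w => \sum_(i < n) excess lam (X i w)) \in Lfun P 1 /\
    ('E_P[fun w => (\sum_(i < n) excess lam (X i w))%R] <= (e *+ n)%:E)%E.
  elim: n {n0 n0'} => [|n [IH1 IH2]].
    under eq_fun do rewrite big_ord0; split; first exact: Lfun_cst.
    by rewrite expectation_cst.
  under eq_fun do rewrite big_ord_recr/=.
  have L := excess_Lfun1 n PPP le_e.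
  split; first exact: Lfun1D.
  rewrite expectationD// mulrSr EFinD leeD//.
  exact: le_trans (excess_identically_distributed n lam PPP) le_e.
rewrite expectationZ// -lee_pdivlMl ?invr_gt0// invrK -EFinM mulr_natl.
exact: LE.
Qed.

End uniform_integrability.

(** * Scaled walks under semiconcave test functions *)

Section law_of_large_numbers.
Context d (T : measurableType d) (R : realType) (PP : set (probability T R)).
Context (PP0 : PP !=set0) (X : nat -> T -> R).
Context (mX : forall i, measurable_fun setT (X i)) (iidX : peng_iid PP X).
Local Notation U := (sublinear_expectation PP).
Context (tailX : forall e : R, 0 < e ->
  exists2 lam : R, 1 <= lam & (U (excess lam \o X 0%N) <= e%:E)%E).
Implicit Types (P : probability T R).

Let idX : identically_distributed PP X := proj1 iidX.

Definition mean P : R := fine 'E_P[X 0%N].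

Section one_step.
Context (psi p : R -> R) (psi_p : semiconcave_with psi p).
Context (mu lam e n : R) (n0 : 0 < n) (lam0 : 0 <= lam).
Context (le_e : (U (excess lam \o X 0%N) <= e%:E)%E).

(** n times the expectation of the semiconcavity remainder; the threshold
    lam + |mu| accounts for centring X at mu. *)
Definition step_error : R := 4 * (lam + `|mu|) ^+ 2 / n + 8 * e.

Let pointwise s x : psi (s + n^-1 * (x - mu)) <=
  (psi s - p s * n^-1 * mu + n^-1 * (4 * (lam + `|mu|) ^+ 2 / n)) +
    p s * n^-1 * x + 8 * n^-1 * excess lam x.
Proof.
apply: le_trans (psi_p _ _) _.
have L0 : 0 <= lam + `|mu| by rewrite addr_ge0.
have h1 := min_sqr_lin_le (x - mu) n0 L0.
have h2 : n^-1 * (8 * excess (lam + `|mu|) (x - mu)) <= n^-1 * (8 * excess lam x).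
  by rewrite ler_wpM2l ?invr_ge0 ?(ltW n0)// ler_wpM2l// excessB.
lra.
Qed.

Let mean_excess P : PP P -> fine 'E_P[excess lam \o X 0%N] <= e.
Proof.
move=> PPP; rewrite -lee_fin fineK.
  exact: le_trans (expectation_le_sublinear _ PPP) le_e.
exact/expectation_fin_num/(excess_Lfun1 mX idX 0%N PPP le_e).
Qed.

Lemma step_expectation_le P s : PP P ->
  ('E_P[fun w => psi (s + n^-1 * (X 0%N w - mu))] <=
    (psi s + n^-1 * (p s * (mean P - mu) + step_error))%:E)%E.
Proof.
move=> PPP; apply: le_trans (expectation_homo P (fun w => pointwise s (X 0%N w))) _.
rewrite (@expectation_affine _ _ _ P (X 0%N) (excess lam \o X 0%N)); last 2 first.
- exact: (variable_Lfun1 mX idX tailX).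
- exact: (excess_Lfun1 mX idX 0%N PPP le_e).
rewrite lee_fin /step_error -/(mean P).
have := ler_wpM2l (ltW (divr_gt0 ltr01 n0)) (mean_excess PPP).
rewrite div1r; lra.
Qed.

Lemma step_expectationN_ge P s : PP P ->
  ((- psi s - n^-1 * (p s * (mean P - mu) + step_error))%:E <=
   'E_P[fun w => (- psi (s + n^-1 * (X 0%N w - mu)))%R])%E.
Proof.
move=> PPP.
have pw w : - (psi s - p s * n^-1 * mu + n^-1 * (4 * (lam + `|mu|) ^+ 2 / n)) +
    - (p s * n^-1) * X 0%N w + - (8 * n^-1) * (excess lam \o X 0%N) w <=
    - psi (s + n^-1 * (X 0%N w - mu)).
  by rewrite !mulNr -!opprD lerN2; exact: pointwise.
apply: le_trans (expectation_homo P pw).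
rewrite (@expectation_affine _ _ _ P (X 0%N) (excess lam \o X 0%N)); last 2 first.
- exact: (variable_Lfun1 mX idX tailX).
- exact: (excess_Lfun1 mX idX 0%N PPP le_e).
rewrite lee_fin /step_error -/(mean P).
have := ler_wpM2l (ltW (divr_gt0 ltr01 n0)) (mean_excess PPP).
rewrite div1r; lra.
Qed.

End one_step.

(** The excess term is made small by the choice of lam, and then the quadratic
    term by n. *)
Lemma step_error_small mu e : 0 < e ->
  exists2 lam : R, 0 <= lam & (U (excess lam \o X 0%N) <= (e / 16)%:E)%E /\
    \forall n \near \oo, step_error mu lam (e / 16) n%:R <= e.
Proof.
move=> e0; have e16 : 0 < e / 16 by rewrite divr_gt0.
have [lam lam1 le_e] := tailX e16.
exists lam; first exact: le_trans lam1.
split => //; near=> n.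
have n0 : 0 < n%:R :> R by rewrite ltr0n; near: n; exact: nbhs_infty_gt.
have : 4 * (lam + `|mu|) ^+ 2 / n%:R <= e / 2.
  rewrite ler_pdivrMr// -ler_pdivrMl ?divr_gt0//.
  by near: n; exact: nbhs_infty_ger.
by rewrite /step_error; lra.
Unshelve. all: by end_near. Qed.

Section semiconcave_test_function.
Context (psi p : R -> R) (psi_p : semiconcave_with psi p) (B K mu : R).
Hypothesis psiB : forall x, `|psi x| <= B.
Hypothesis psiK : forall x y, `|psi x - psi y| <= K * `|x - y|.

(** With a drift of favourable sign under every P, each of the n steps costs at
    most e / n. *)
Lemma walk_limsup e : (forall s P, PP P -> p s * (mean P - mu) <= 0) -> 0 < e ->
  \forall n \near \oo, (U (psi \o walk X n%:R^-1 mu n) <= (psi 0 + e)%:E)%E.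
Proof.
move=> pmu e0; have [lam lam0 [le_e small]] := step_error_small mu e0.
near=> n; have n0 : 0 < n%:R :> R by rewrite ltr0n; near: n; exact: nbhs_infty_gt.
have -> : psi 0 + e = psi 0 + (n%:R^-1 * e) *+ n.
  by rewrite -mulr_natl mulVKf ?gt_eqF.
apply: (walk_expectation_le PP0 mX iidX psiB psiK) => s.
apply: sublinear_le => P PPP.
apply: le_trans (step_expectation_le psi_p _ n0 lam0 le_e _ PPP) _.
rewrite lee_fin lerD2l ler_wpM2l ?invr_ge0 ?(ltW n0)//.
rewrite -[leRHS]add0r lerD ?pmu//.
by near: n.
Unshelve. all: by end_near. Qed.

(** The hypothesis says, for every s, that the supremum over PP of the drift
    - p s * (mean P - mu) is nonnegative, without asking that it be attained. *)
Lemma walk_liminf e :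
  (forall s c, (forall P, PP P -> - (p s * (mean P - mu)) <= c) -> 0 <= c) -> 0 < e ->
  \forall n \near \oo, ((- psi 0 - e)%:E <= U (fun w => (- psi (walk X n%:R^-1 mu n w))%R))%E.
Proof.
move=> pmu e0; have [lam lam0 [le_e small]] := step_error_small mu e0.
near=> n; have n0 : 0 < n%:R :> R by rewrite ltr0n; near: n; exact: nbhs_infty_gt.
have -> : - psi 0 - e = - psi 0 - (n%:R^-1 * e) *+ n.
  by rewrite -mulr_natl mulVKf ?gt_eqF.
have NB x : `|- psi x| <= B by rewrite normrN.
apply: (@walk_expectation_ge _ _ _ _ PP0 _ mX iidX (\- psi) B K) => //.
  by move=> x y; rewrite /= -opprD normrN.
move=> s; set Y := (fun w => _).
have fY : U Y \is a fin_num by apply: (@sublinear_fin_num _ _ _ _ _ B) => // w; exact: NB.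
rewrite -(fineK fY) lee_fin /=.
(* This value of c is the drift bound that the one-step inequality yields under
   each P, after solving it for the drift; 0 <= c is then the claim. *)
have := pmu s (n%:R * (fine (U Y) + psi s) + e).
have h P : PP P -> - (p s * (mean P - mu)) <= n%:R * (fine (U Y) + psi s) + e.
  move=> PPP; have := step_expectationN_ge psi_p mu n0 lam0 le_e s PPP.
  move=> /le_trans /(_ (expectation_le_sublinear _ PPP)).
  rewrite -(fineK fY) lee_fin => h.
  have se : step_error mu lam (e / 16) n%:R <= e by near: n.
  have : n%:R * (- psi s - n%:R^-1 * (p s * (mean P - mu) + step_error mu lam (e / 16) n%:R))
    <= n%:R * fine (U Y) by rewrite ler_pM2l.
  rewrite mulrBr mulVKf ?gt_eqF//; lra.
move=> /(_ h) h'.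
have : 0 <= n%:R^-1 * (n%:R * (fine (U Y) + psi s) + e) by rewrite mulr_ge0 ?invr_ge0 ?(ltW n0).
rewrite mulrDr mulKf ?gt_eqF//; lra.
Unshelve. all: by end_near. Qed.

End semiconcave_test_function.

End law_of_large_numbers.

(** * Dominating a continuous function of linear growth *)

Section domination.
Context {R : realType}.
Implicit Types (x y s u l mu : R).

Lemma continuous_oscillation (phi : R -> R) u e : continuous phi -> 0 < e ->
  exists2 dlt : R, 0 < dlt & forall x, `|x - u| < dlt -> `|phi x - phi u| < e.
Proof.
move=> cphi e0; have /cvgrPdist_lt /(_ e e0) := cphi u.
case/nbhs_ballP => dlt /= dlt0 h; exists dlt => // x xu.
by rewrite distrC; apply: h; rewrite /ball/= distrC.
Qed.

(** Continuity at the two endpoints is enough: inside [l, u] the function is at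
    most M, and within dlt of an endpoint it is at most M + e. *)
Lemma above_max_far (phi : R -> R) l u M e : continuous phi -> l <= u ->
  (forall x, l <= x <= u -> phi x <= M) -> 0 < e ->
  exists2 kap : R, 0 < kap &
    forall x, phi x - M <= e \/ kap <= overshoot (x - u) + undershoot (x - l).
Proof.
move=> cphi lu phiM e0.
have [du du0 hu] := continuous_oscillation u cphi e0.
have [dl dl0 hl] := continuous_oscillation l cphi e0.
exists (tsqr (Num.min du dl)); first by rewrite tsqr_gt0// lt_min du0.
move=> x.
have o0 : 0 <= overshoot (x - u) by exact: tsqr_ge0.
have u0 : 0 <= undershoot (x - l) by exact: tsqr_ge0.
have m0 : 0 < Num.min du dl by rewrite lt_min du0.
have [xu|xu] := ltP u x.
  have [xdu|xdu] := ltP `|x - u| du.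
    left; have := hu x xdu => /ltr_normlW; have := phiM u; rewrite lu lexx => /(_ isT); lra.
  right; apply: ler_wpDr => //; apply: le_tsqr.
  rewrite max_l ?subr_ge0 ?(ltW xu)// (gtr0_norm m0).
  by rewrite ge_min xdu.
have [xl|xl] := ltP x l.
  have [xdl|xdl] := ltP `|x - l| dl.
    left; have := hl x xdl => /ltr_normlW; have := phiM l; rewrite lu lexx => /(_ isT); lra.
  right; apply: ler_wpDl => //; apply: le_tsqr.
  rewrite max_l ?oppr_ge0 ?subr_le0 ?(ltW xl)// normrN (gtr0_norm m0).
  by rewrite ge_min xdl orbT.
left; have := phiM x; rewrite xl xu => /(_ isT); lra.
Qed.

Lemma below_value_far (phi : R -> R) mu e : continuous phi -> 0 < e ->
  exists2 kap : R, 0 < kap & forall x, phi mu - phi x <= e \/ kap <= tsqr (x - mu).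
Proof.
move=> cphi e0; have [dlt dlt0 h] := continuous_oscillation mu cphi e0.
exists (tsqr dlt); first exact: tsqr_gt0.
move=> x; have [xm|xm] := ltP `|x - mu| dlt.
  by left; have := h x xm; rewrite distrC => /ltr_normlW/ltW.
by right; apply: le_tsqr; rewrite (gtr0_norm dlt0).
Qed.

(** Where f exceeds e, q is at least kap and pays for f on |x| <= 2 lam; beyond,
    the excess is at least |x| / 2 and pays for the linear growth.  The
    coefficient of the excess does not depend on lam, which may therefore be
    chosen afterwards to make the expected excess small. *)
Lemma linear_growth_domination (f q : R -> R) (C lam e kap : R) :
  0 < C -> 1 <= lam -> 0 <= e -> 0 < kap ->
  (forall x, f x <= C * (1 + `|x|)) -> (forall x, 0 <= q x) ->
  (forall x, f x <= e \/ kap <= q x) ->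
  forall x, f x <= e + C * (1 + 2 * lam) / kap * q x + 4 * C * excess lam x.
Proof.
move=> C0 lam1 e0 kap0 fC q0 fq x.
have A0 : 0 <= C * (1 + 2 * lam) / kap.
  by rewrite mulr_ge0 ?invr_ge0 ?(ltW kap0)// mulr_ge0 ?(ltW C0)//; lra.
have Aq : 0 <= C * (1 + 2 * lam) / kap * q x by rewrite mulr_ge0.
have Cx : 0 <= 4 * C * excess lam x by rewrite mulr_ge0 ?excess_ge0// mulr_ge0// ltW.
have [fe|kq] := fq x; first by lra.
have [xl|xl] := leP `|x| (2 * lam).
  have : C * (1 + `|x|) <= C * (1 + 2 * lam) by rewrite ler_wpM2l ?(ltW C0)// lerD2l.
  have : C * (1 + 2 * lam) <= C * (1 + 2 * lam) / kap * q x.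
    rewrite -mulrA ler_peMr//; first by rewrite mulr_ge0 ?(ltW C0)//; lra.
    by rewrite mulrC ler_pdivlMr// mul1r.
  have := fC x; lra.
have ex : `|x| - lam <= excess lam x by rewrite le_max lexx.
have : C * (1 + `|x|) <= C * (4 * excess lam x) by rewrite ler_wpM2l ?(ltW C0)//; lra.
have := fC x; lra.
Qed.

End domination.

(** * The law of large numbers *)

Section peng_law_of_large_numbers.
Context d (T : measurableType d) (R : realType) (PP : set (probability T R)).
Context (PP0 : PP !=set0) (X : nat -> T -> R).
Context (mX : forall i, measurable_fun setT (X i)) (iidX : peng_iid PP X).
Local Notation U := (sublinear_expectation PP).
Context (tailX : forall e : R, 0 < e ->
  exists2 lam : R, 1 <= lam & (U (excess lam \o X 0%N) <= e%:E)%E).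
Implicit Types (P : probability T R).

Let idX : identically_distributed PP X := proj1 iidX.
Let X1 P i : PP P -> X i \in Lfun P 1 := @variable_Lfun1 _ _ _ _ _ mX idX tailX P i.

Definition upper_mean : R := fine (U (X 0%N)).
Definition lower_mean : R := - fine (U (fun w => - X 0%N w)).
Local Notation mean := (mean X).
Local Notation sample_mean n := (fun w => (\sum_(i < n) X i w) / n%:R).

Lemma sublinear_variable_fin_num (Y : T -> R) : measurable_fun setT Y ->
  (forall w, `|Y w| <= `|X 0%N w|) -> U Y \is a fin_num.
Proof.
move=> mY YX; have [lam lam1 le1] := tailX ltr01.
rewrite fin_numElt; apply/andP; split.
  have [P PPP] := PP0; apply: lt_le_trans (expectation_le_sublinear Y PPP).
  rewrite ltNye; apply/eqP => EY.
  have : Y \in Lfun P 1.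
    apply: (le_Lfun1 mY YX); exact: (Lfun_norm (X1 0%N PPP)).
  by move/expectation_fin_num; rewrite EY.
apply: (@le_lt_trans _ _ (1 + lam)%:E); last exact: ltry.
apply: sublinear_le => P PPP.
apply: (@le_trans _ _ 'E_P[fun w => (excess lam (X 0%N w) + lam)%R]%E).
  apply: expectation_homo => w; rewrite addrC.
  exact: le_trans (ler_norm _) (le_trans (YX w) (norm_le_excess _ _)).
rewrite (@expectationDcst _ _ _ _ (excess lam \o X 0%N)).
  by rewrite EFinD leeD2r// (le_trans (expectation_le_sublinear _ PPP)).
exact: (excess_Lfun1 mX idX 0%N PPP le1).
Qed.

Lemma upper_meanE : U (X 0%N) = upper_mean%:E.
Proof. by rewrite /upper_mean fineK// sublinear_variable_fin_num. Qed.

Lemma lower_meanE : U (fun w => - X 0%N w) = (- lower_mean)%:E.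
Proof.
rewrite /lower_mean opprK fineK// sublinear_variable_fin_num//.
  exact: measurableT_comp.
by move=> w; rewrite normrN.
Qed.

Lemma meanE P : PP P -> 'E_P[X 0%N]%E = (mean P)%:E.
Proof. by move=> PPP; rewrite fineK// expectation_fin_num// X1. Qed.

Lemma meanNE P : PP P -> 'E_P[fun w => (- X 0%N w)%R]%E = (- mean P)%:E.
Proof.
move=> PPP; rewrite (_ : (fun w => _) = fun w => -1 * X 0%N w); last first.
  by apply/funext => w; rewrite mulN1r.
by rewrite expectationZ ?X1// meanE// -EFinM mulN1r.
Qed.

Lemma mean_le_upper P : PP P -> mean P <= upper_mean.
Proof.
by move=> PPP; rewrite -lee_fin -meanE// -upper_meanE expectation_le_sublinear.
Qed.

Lemma mean_ge_lower P : PP P -> lower_mean <= mean P.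
Proof.
move=> PPP; rewrite -lerN2 -lee_fin -meanNE// -lower_meanE.
exact: expectation_le_sublinear.
Qed.

Lemma upper_mean_le c : (forall P, PP P -> mean P <= c) -> upper_mean <= c.
Proof.
move=> h; rewrite -lee_fin -upper_meanE; apply: sublinear_le => P PPP.
by rewrite meanE// lee_fin h.
Qed.

Lemma lower_mean_ge c : (forall P, PP P -> c <= mean P) -> c <= lower_mean.
Proof.
move=> h; rewrite -lerN2 -lee_fin -lower_meanE; apply: sublinear_le => P PPP.
by rewrite meanNE// lee_fin lerN2 h.
Qed.

Lemma lower_le_upper : lower_mean <= upper_mean.
Proof.
have [P PPP] := PP0; exact: le_trans (mean_ge_lower PPP) (mean_le_upper PPP).
Qed.

Lemma walkE mu n w : (0 < n)%N ->
  walk X n%:R^-1 mu n w = (\sum_(i < n) X i w) / n%:R - mu.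
Proof.
move=> n0; rewrite /walk -mulr_sumr sumrB sumr_const card_ord mulrBr mulrC.
by rewrite -(mulr_natl mu) mulKf// pnatr_eq0 -lt0n.
Qed.

(** The slope of overshoot is nonnegative and no P has mean above upper_mean. *)
Lemma overshoot_sample_mean e : 0 < e -> \forall n \near \oo,
  (U (fun w => overshoot (sample_mean n w - upper_mean)%R) <= e%:E)%E.
Proof.
move=> e0.
have h := @walk_limsup _ _ _ _ PP0 _ mX iidX tailX _ _ overshoot_semiconcave
  1 2 upper_mean (fun x => norm_tsqr_le1 _) overshoot_lipschitz e _ e0.
near=> n; have n0 : (0 < n)%N by near: n; exact: nbhs_infty_gt.
have -> : (fun w => overshoot (sample_mean n w - upper_mean)) =
    overshoot \o walk X n%:R^-1 upper_mean n.
  by apply/funext => w /=; rewrite walkE.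
rewrite -[e]add0r -[X in X + e]overshoot0; near: n; apply: h => s P PPP.
rewrite mulr_ge0_le0 ?subr_le0 ?mean_le_upper// tsqr_slope_ge0//.
by rewrite le_max lexx orbT.
Unshelve. all: by end_near. Qed.

Lemma undershoot_sample_mean e : 0 < e -> \forall n \near \oo,
  (U (fun w => undershoot (sample_mean n w - lower_mean)%R) <= e%:E)%E.
Proof.
move=> e0.
have h := @walk_limsup _ _ _ _ PP0 _ mX iidX tailX _ _ undershoot_semiconcave
  1 2 lower_mean (fun x => norm_tsqr_le1 _) undershoot_lipschitz e _ e0.
near=> n; have n0 : (0 < n)%N by near: n; exact: nbhs_infty_gt.
have -> : (fun w => undershoot (sample_mean n w - lower_mean)) =
    undershoot \o walk X n%:R^-1 lower_mean n.
  by apply/funext => w /=; rewrite walkE.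
rewrite -[e]add0r -[X in X + e]undershoot0; near: n; apply: h => s P PPP.
rewrite mulr_le0_ge0 ?subr_ge0 ?mean_ge_lower// oppr_le0 tsqr_slope_ge0//.
by rewrite le_max lexx orbT.
Unshelve. all: by end_near. Qed.

(** A nonnegative slope is countered by measures with mean near lower_mean, a
    negative one by measures with mean near upper_mean. *)
Lemma concentration_sample_mean mu e : lower_mean <= mu <= upper_mean -> 0 < e ->
  \forall n \near \oo, ((- e)%:E <= U (fun w => (- tsqr (sample_mean n w - mu))%R))%E.
Proof.
move=> /andP[lmu muu] e0.
have h := @walk_liminf _ _ _ _ PP0 _ mX iidX tailX _ _ tsqr_semiconcave
  1 2 mu (@norm_tsqr_le1 _) (@tsqr_lipschitz _) e _ e0.
near=> n; have n0 : (0 < n)%N by near: n; exact: nbhs_infty_gt.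
have -> : (fun w => - tsqr (sample_mean n w - mu)) =
    (fun w => - tsqr (walk X n%:R^-1 mu n w)).
  by apply/funext => w /=; rewrite walkE.
rewrite -[- e]add0r -oppr0 -[X in - X - e](@tsqr0 R); near: n; apply: h => s c sc.
have [p0|p0|p0] := ltgtP (tsqr_slope s) 0.
- have cE : c = tsqr_slope s * (c / tsqr_slope s) by rewrite mulrCA mulfV ?mulr1 ?lt_eqF.
  have : upper_mean <= mu - c / tsqr_slope s.
    apply: upper_mean_le => P PPP; have := sc P PPP.
    by rewrite -mulrN opprB [leRHS]cE ler_nM2l// lerBrDr addrC -lerBrDr.
  by move=> h'; rewrite cE mulr_le0 ?(ltW p0)//; lra.
- have cE : c = tsqr_slope s * (c / tsqr_slope s) by rewrite mulrCA mulfV ?mulr1 ?gt_eqF.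
  have : mu - c / tsqr_slope s <= lower_mean.
    apply: lower_mean_ge => P PPP; have := sc P PPP.
    by rewrite -mulrN opprB [leRHS]cE ler_pM2l// lerBlDr addrC -lerBlDr.
  by move=> h'; rewrite cE mulr_ge0 ?(ltW p0)//; lra.
- by have [P PPP] := PP0; have := sc P PPP; rewrite p0 mul0r oppr0.
Unshelve. all: by end_near. Qed.

Section continuous_function.
Context (phi : R -> R) (cphi : continuous phi) (C : R) (C0 : 0 < C).
Context (phiC : forall x, `|phi x| <= C * (1 + `|x|)).

Let growth a x : `|phi x - a| <= (C + `|a|) * (1 + `|x|).
Proof.
apply: le_trans (ler_normB _ _) _; rewrite [leRHS]mulrDl lerD//.
by rewrite ler_peMr// lerDl.
Qed.

Let measurable_sample_mean n : measurable_fun setT (sample_mean n).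
Proof.
by apply: measurable_funM => //; exact: measurable_sum.
Qed.

Let excess_sample_mean_Lfun1 P n lam : PP P -> 0 <= lam ->
  (fun w => excess lam (sample_mean n w)) \in Lfun P 1.
Proof.
move=> PPP lam0; apply: (@le_Lfun1 _ _ _ _ _ (fun w => `|sample_mean n w|)).
- by apply: measurableT_comp (measurable_excess _) _; exact: measurable_sample_mean.
- move=> w; rewrite ger0_norm ?excess_ge0// /excess ge_max normr_ge0 andbT.
  by rewrite lerBlDr lerDl.
- by apply: (Lfun_norm (mean_Lfun1 mX idX tailX n PPP)).
Qed.

Let bounded_test_Lfun1 P n (psi : R -> R) a : (forall x, `|psi x| <= 1) ->
  (forall x y, `|psi x - psi y| <= 2 * `|x - y|) ->
  (fun w => psi (sample_mean n w - a)) \in Lfun P 1.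
Proof.
move=> psi1 psi2; apply: (@bounded_Lfun1 _ _ _ _ _ 1) => //.
apply: measurableT_comp (lipschitz_measurable psi2) _.
by apply: measurable_funB => //; exact: measurable_sample_mean.
Qed.

(** Of the error 4 e, one part is the oscillation of phi near the interval, one
    comes from each of the two one-sided test functions, and one from the
    excess. *)
Lemma limsup_sample_mean M e : 0 < e ->
  (forall x, lower_mean <= x <= upper_mean -> phi x <= M) ->
  \forall n \near \oo, (U (fun w => phi (sample_mean n w)) <= (M + 4 * e)%:E)%E.
Proof.
move=> e0 phiM.
have [kap kap0 far] := above_max_far cphi lower_le_upper phiM e0.
pose C' := C + `|M|; have C'0 : 0 < C' by rewrite ltr_wpDr.
have e20 : 0 < e / (4 * C') by rewrite divr_gt0// mulr_gt0.
have [lam lam1 le_e] := tailX e20.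
have lam0 : 0 <= lam by exact: le_trans lam1.
pose A := C' * (1 + 2 * lam) / kap.
have A0 : 0 < A by rewrite divr_gt0// mulr_gt0//; lra.
have e10 : 0 < e / A by rewrite divr_gt0.
near=> n.
have n0 : (0 < n)%N by near: n; exact: nbhs_infty_gt.
have over : (U (fun w => overshoot (sample_mean n w - upper_mean)%R) <= (e / A)%:E)%E.
  by near: n; exact: overshoot_sample_mean.
have under : (U (fun w => undershoot (sample_mean n w - lower_mean)%R) <= (e / A)%:E)%E.
  by near: n; exact: undershoot_sample_mean.
apply: sublinear_le => P PPP.
pose Z w :=
  overshoot (sample_mean n w - upper_mean) +
  undershoot (sample_mean n w - lower_mean).
pose E w := excess lam (sample_mean n w).
have pointwise w : phi (sample_mean n w) <= (M + e) + A * Z w + 4 * C' * E w.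
  have := @linear_growth_domination _ (fun x => phi x - M)
    (fun x => overshoot (x - upper_mean) + undershoot (x - lower_mean)) C' lam e kap
    C'0 lam1 (ltW e0) kap0 _ _ far (sample_mean n w).
  rewrite -/(Z w) -/(E w) -/A => h.
  have : phi (sample_mean n w) - M <= e + A * Z w + 4 * C' * E w.
    by apply: h => x; [exact: le_trans (ler_norm _) (growth _ _)|rewrite addr_ge0 ?tsqr_ge0].
  lra.
apply: le_trans (expectation_homo P pointwise) _.
have o1 : (fun w => overshoot (sample_mean n w - upper_mean)) \in Lfun P 1.
  by apply: bounded_test_Lfun1; [move=> x; exact: norm_tsqr_le1|exact: overshoot_lipschitz].
have u1 : (fun w => undershoot (sample_mean n w - lower_mean)) \in Lfun P 1.
  by apply: bounded_test_Lfun1; [move=> x; exact: norm_tsqr_le1|exact: undershoot_lipschitz].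
have E1 : E \in Lfun P 1 by exact: excess_sample_mean_Lfun1.
have Z1 : Z \in Lfun P 1 by exact: Lfun1D.
rewrite expectation_affine// lee_fin.
have EZ : A * fine 'E_P[Z] <= 2 * e.
  rewrite -ler_pdivlMl// -lee_fin fineK ?expectation_fin_num//.
  rewrite (_ : A^-1 * (2 * e) = e / A + e / A); last by ring.
  by rewrite expectationD// EFinD leeD// (le_trans (expectation_le_sublinear _ PPP)).
have EE : 4 * C' * fine 'E_P[E] <= e.
  rewrite -ler_pdivlMl ?mulr_gt0// mulrC -lee_fin fineK ?expectation_fin_num//.
  exact: (excess_mean_le mX idX PPP n0 lam0 le_e).
lra.
Unshelve. all: by end_near. Qed.

(** All estimates are made under a single P that nearly attains the sublinear
    expectation of the truncated square; being at most twice the allowed error,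
    it accounts for two of the four e. *)
Lemma liminf_sample_mean mu e : 0 < e -> lower_mean <= mu <= upper_mean ->
  \forall n \near \oo, ((phi mu - 4 * e)%:E <= U (fun w => phi (sample_mean n w)))%E.
Proof.
move=> e0 lmuu.
have [kap kap0 far] := below_value_far mu cphi e0.
pose C' := C + `|phi mu|; have C'0 : 0 < C' by rewrite ltr_wpDr.
have e20 : 0 < e / (4 * C') by rewrite divr_gt0// mulr_gt0.
have [lam lam1 le_e] := tailX e20.
have lam0 : 0 <= lam by exact: le_trans lam1.
pose A := C' * (1 + 2 * lam) / kap.
have A0 : 0 < A by rewrite divr_gt0// mulr_gt0//; lra.
have e10 : 0 < e / A by rewrite divr_gt0.
near=> n.
have n0 : (0 < n)%N by near: n; exact: nbhs_infty_gt.
have conc : ((- (e / A))%:E <= U (fun w => (- tsqr (sample_mean n w - mu))%R))%E.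
  by near: n; exact: concentration_sample_mean.
pose Z w := - tsqr (sample_mean n w - mu).
pose E w := excess lam (sample_mean n w).
have [P PPP PZ] : exists2 P, PP P & ((- (2 * (e / A)))%:E <= 'E_P[Z])%E.
  apply: contrapT => noP.
  have : (U Z <= (- (2 * (e / A)))%:E)%E.
    apply: sublinear_le => P PPP; rewrite leNgt; apply/negP => /ltW h.
    by apply: noP; exists P.
  by move=> /(le_trans conc); rewrite lee_fin; lra.
have pointwise w : (phi mu - e) + A * Z w + - (4 * C') * E w <= phi (sample_mean n w).
  have := @linear_growth_domination _ (fun x => phi mu - phi x)
    (fun x => tsqr (x - mu)) C' lam e kap
    C'0 lam1 (ltW e0) kap0 _ (fun x => tsqr_ge0 _) far (sample_mean n w).
  rewrite -/(E w) -/A -[X in A * X]opprK -/(Z w).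
  move=> h; have : phi mu - phi (sample_mean n w) <= e + A * - Z w + 4 * C' * E w.
    by apply: h => x; rewrite -opprB (le_trans (ler_norm _))// normrN growth.
  lra.
apply: le_trans (expectation_le_sublinear _ PPP).
apply: le_trans (expectation_homo P pointwise).
have Z1 : Z \in Lfun P 1.
  apply: (@bounded_test_Lfun1 _ _ (fun x => - tsqr x)) => [x|x y].
    by rewrite normrN norm_tsqr_le1.
  by rewrite -opprD normrN tsqr_lipschitz.
have E1 : E \in Lfun P 1 by exact: excess_sample_mean_Lfun1.
rewrite expectation_affine// lee_fin.
have EZ : - (2 * e) <= A * fine 'E_P[Z].
  rewrite -ler_pdivrMl// -lee_fin fineK ?expectation_fin_num//.
  by rewrite (_ : A^-1 * - (2 * e) = - (2 * (e / A))); last ring.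
have EE : 4 * C' * fine 'E_P[E] <= e.
  rewrite -ler_pdivlMl ?mulr_gt0// mulrC -lee_fin fineK ?expectation_fin_num//.
  exact: (excess_mean_le mX idX PPP n0 lam0 le_e).
lra.
Unshelve. all: by end_near. Qed.

Lemma sample_mean_cvg mu : lower_mean <= mu <= upper_mean ->
  (forall x, lower_mean <= x <= upper_mean -> phi x <= phi mu) ->
  U (fun w => phi (sample_mean n w)) @[n --> \oo] --> (phi mu)%:E.
Proof.
move=> lmuu mu_max.
have bounds e : 0 < e -> \forall n \near \oo,
    ((phi mu - e)%:E <= U (fun w => phi (sample_mean n w)) <= (phi mu + e)%:E)%E.
  move=> e0; have e40 : 0 < e / 4 by rewrite divr_gt0.
  near=> n; rewrite (_ : e = 4 * (e / 4)); last by rewrite mulrC divfK.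
  apply/andP; split; near: n.
  - exact: liminf_sample_mean.
  - exact: limsup_sample_mean.
have fin : \forall n \near \oo, U (fun w => phi (sample_mean n w)) \is a fin_num.
  near=> n; have /andP[lo up] : ((phi mu - 1)%:E <=
      U (fun w => phi (sample_mean n w)) <= (phi mu + 1)%:E)%E.
    by near: n; exact: bounds.
  by rewrite fin_numElt (lt_le_trans _ lo) ?ltNyr// (le_lt_trans up) ?ltry.
apply/fine_cvgP; split=> //; apply/cvgrPdist_le => e e0; near=> n.
have fn : U (fun w => phi (sample_mean n w)) \is a fin_num by near: n.
have : ((phi mu - e)%:E <= U (fun w => phi (sample_mean n w)) <= (phi mu + e)%:E)%E.
  by near: n; exact: bounds.
rewrite /= -{1 2}(fineK fn) !lee_fin distrC ler_distl => /andP[-> ->]//.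
Unshelve. all: by end_near. Qed.

End continuous_function.

End peng_law_of_large_numbers.

Theorem theorem4p4 (R : realType) (Omega : completeMetricType R)
    (sepOmega : separable Omega)
    (PP : set (probability (borel Omega) R)) (PP0 : PP !=set0)
    (X : nat -> {mfun borel Omega >-> R})
    (iidX : peng_iid PP X)
    (tailX : (fun lambda : R => sublinear_expectation PP
               (fun w => Num.max (`|X 0%N w| - lambda) 0)) @ +oo --> 0%E)
    (phi : R -> R) (cphi : continuous phi) (growth_phi : linear_growth phi) :
  exists2 M : R,
    is_maximum
      (phi @` [set mu : R |
         (- sublinear_expectation PP (fun w => (- X 0%N w)%R) <= mu%:E
            <= sublinear_expectation PP (X 0%N))%E]) M &
    sublinear_expectation PP
      (fun w => phi ((\sum_(i < n) X i w) / n%:R)) @[n --> \oo] --> M%:E.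
Proof.
pose Y i : borel Omega -> R := X i.
have mY i : measurable_fun setT (Y i) by exact: measurable_funPT.
have tailY (e : R) : 0 < e -> exists2 lam : R, 1 <= lam &
    (sublinear_expectation PP (excess lam \o Y 0%N) <= e%:E)%E.
  move=> e0; have /fine_cvgP [tfin tcvg] := tailX.
  move/cvgrPdist_le : tcvg => /(_ e e0) tcvg.
  near (pinfty_nbhs R) => lam; exists lam; first by near: lam; exact: nbhs_pinfty_ge.
  have fl : sublinear_expectation PP (excess lam \o Y 0%N) \is a fin_num by near: lam.
  have : `|0 - fine (sublinear_expectation PP (excess lam \o Y 0%N))| <= e by near: lam.
  by rewrite sub0r normrN -{2}(fineK fl) lee_fin => /ler_normlW.
have -> : [set mu : R | (- sublinear_expectation PP (fun w => (- X 0%N w)%R) <= mu%:E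
            <= sublinear_expectation PP (X 0%N))%E] =
    [set mu | lower_mean PP Y <= mu <= upper_mean PP Y].
  apply/seteqP; split => mu /=;
    rewrite -/(Y 0%N) (lower_meanE PP0 mY iidX tailY) (upper_meanE PP0 mY iidX tailY);
    by rewrite -EFinN opprK !lee_fin.
have [C phiC] := growth_phi.
have lu := lower_le_upper PP0 mY iidX tailY.
have [mu] := EVT_max lu (continuous_subspaceT cphi).
rewrite in_itv /= => mulu mu_max.
have mu_max' x : lower_mean PP Y <= x <= upper_mean PP Y -> phi x <= phi mu.
  by move=> xlu; apply: mu_max; rewrite in_itv.
exists (phi mu); first by split; [exists mu|move=> _ [x xlu <-]; exact: mu_max'].
have C0 : 0 < `|C| + 1 by rewrite ltr_wpDl.
apply: (sample_mean_cvg PP0 mY iidX tailY cphi C0 _ mulu mu_max') => x.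
apply: le_trans (phiC x) _; rewrite ler_wpM2r ?addr_ge0//.
by rewrite (le_trans (ler_norm _))// lerDl.
Unshelve. all: by end_near. Qed.
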